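(* On $\mathbb{N}^3$ let $A_n=\{(n+1,n,n),(n,n+1,n),(n,n,n+1)\}$ and $B_n=\{(n,n+1,n+1),(n+1,n,n+1),(n+1,n+1,n)\}$, and let $\mu$ be the probability measure with $\mu(x)=\frac{1}{(\pi n)^2}$ for $x\in A_n\cup B_n$ and $\mu(x)=0$ for $x\notin\bigcup_n(A_n\cup B_n)$. Put $\mu_{ij}=\mathrm{Pr}_{ij}(\mu)$ and let $c:\mathbb{N}^3\to\{0,1\}$ with $c=1$ on $\bigcup_nB_n$ and $c=0$ elsewhere. Then $\mu$ is the only probability measure on $\mathbb{N}^3$ with projections $\mu_{12},\mu_{13},\mu_{23}$ (hence it is the unique optimal plan), and there are no functions $f_{ij}:\mathbb{N}^2\to[-\infty,+\infty)$ such that $f_{12}(n_1,n_2)+f_{13}(n_1,n_3)+f_{23}(n_2,n_3)\le c(n_1,n_2,n_3)$ for all $(n_1,n_2,n_3)\in\mathbb{N}^3$ with equality $\mu$-almost everywhere. In particular $\mu$ is not strongly $c$-monotone.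
   Context: $\mathrm{Pr}_{ij}$ is the projection of $\mathbb{N}^3$ onto coordinates $(i,j)$. A plan $\pi$ is strongly $c$-monotone if it is concentrated on a Borel set $\Gamma$ for which there exist Borel functions $f_{ij}:X_i\times X_j\to[-\infty,+\infty)$ with $\sum f_{ij}\le c$ everywhere and equality on $\Gamma$. *)

(* Defs.v *)
From HB Require Import structures.
From mathcomp Require Import all_boot all_order all_algebra.
From mathcomp Require Import all_classical all_reals all_analysis measurable_realfun.
Set Implicit Arguments. Unset Strict Implicit. Unset Printing Implicit Defensive.
Import Order.TTheory GRing.Theory Num.Theory.
Local Open Scope classical_set_scope.
Local Open Scope ring_scope.

(* Points of N^3 are triples ((n1, n2), n3) : nat * nat * nat, with the
   discrete sigma-algebra on nat and the product sigma-algebra on products. *)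
Notation N3 := (nat * nat * nat)%type.

Definition pr12 (x : N3) : nat * nat := (x.1.1, x.1.2).
Definition pr13 (x : N3) : nat * nat := (x.1.1, x.2).
Definition pr23 (x : N3) : nat * nat := (x.1.2, x.2).

Definition A_ (n : nat) : set N3 :=
  [set (n.+1, n, n); (n, n.+1, n); (n, n, n.+1)].
Definition B_ (n : nat) : set N3 :=
  [set (n, n.+1, n.+1); (n.+1, n, n.+1); (n.+1, n.+1, n)].

(* The index n ranges over n >= 1 (needed for mu to have total mass 1). *)
Definition is_mu (R : realType) (P : set N3 -> \bar R) : Prop :=
  (forall n : nat, (0 < n)%N -> forall x, (A_ n `|` B_ n) x ->
      P [set x] = ((pi * n%:R) ^- 2)%:E) /\
  (forall x, (forall n : nat, (0 < n)%N -> ~ (A_ n `|` B_ n) x) ->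
      P [set x] = 0%E).

Definition cost (R : realType) (x : N3) : R :=
  if `[< exists n : nat, (0 < n)%N /\ B_ n x >] then 1 else 0.

Definition no_pinfty (R : realType) (f : nat -> nat -> \bar R) : Prop :=
  forall a b, f a b != +oo%E.

Definition fsum (R : realType) (f12 f13 f23 : nat -> nat -> \bar R) (x : N3)
  : \bar R := (f12 x.1.1 x.1.2 + f13 x.1.1 x.2 + f23 x.1.2 x.2)%E.

Definition strongly_c_monotone (R : realType)
    (P : {measure set N3 -> \bar R}) (c : N3 -> R) : Prop :=
  exists Gamma : set N3, measurable Gamma /\ P (~` Gamma) = 0%E /\
  exists f12 f13 f23 : nat -> nat -> \bar R,
    [/\ no_pinfty f12, no_pinfty f13 & no_pinfty f23] /\
    [/\ measurable_fun [set: nat * nat] ((fun p => f12 p.1 p.2) : nat * nat -> \bar R),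
        measurable_fun [set: nat * nat] ((fun p => f13 p.1 p.2) : nat * nat -> \bar R) &
        measurable_fun [set: nat * nat] ((fun p => f23 p.1 p.2) : nat * nat -> \bar R)] /\
    (forall x, (fsum f12 f13 f23 x <= (c x)%:E)%E) /\
    (forall x, Gamma x -> fsum f12 f13 f23 x = (c x)%:E).

(* Main.v *)
(** Existence amounts to [sum_(n >= 1) 6 / (pi n)^2 = 1], i.e. the Basel sum.
    Writing [U_n] for the sum of [1 / sin^2] over the angles
    [k pi / 2^(n+1)], [0 < k < 2^n], the duplication formula
    [1 / sin^2 x + 1 / cos^2 x = 4 / sin^2 (2 x)] gives [U_(n+1) = 4 U_n + 2],
    and [1 / sin^2 x - 1 <= 1 / x^2 <= 1 / sin^2 x] does the rest.

    Uniqueness: let [Q] have the marginals of [mu] and [d = Q - mu] on points.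
    The marginals force [Q] to live on the [A_n], the [B_n] and the diagonal.
    The fibres over [(n, n+1)] and [(n+1, n)] show that [d] is a constant [a_n]
    on [A_n] and [- a_n] on [B_n]; the fibres over [(n, n)] then give
    [a_n = a_(n-1) - Q (n, n, n)] with [a_0 = 0]. So [a_n] decreases from [0],
    while [a_n >= - mu (A_n) -> 0]; hence [a = 0].

    Potentials: put [F n = f12 n n + f13 n n + f23 n n <= c (n, n, n) = 0].
    Subtracting the three equalities on [A_n] from those on [B_n] cancels all
    off-diagonal terms and leaves [F (n+1) - F n = 3], which is absurd. *)
Require Import Defs.
From HB Require Import structures.
From mathcomp Require Import all_boot all_order all_algebra.
From mathcomp Require Import all_classical all_reals all_analysis measurable_realfun.
From mathcomp Require Import zify ring lra.
Set Implicit Arguments. Unset Strict Implicit. Unset Printing Implicit Defensive.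
Import Order.TTheory GRing.Theory Num.Theory.
Import numFieldNormedType.Exports.
Local Open Scope classical_set_scope.
Local Open Scope ring_scope.

(** * The Basel sum *)

Lemma sin_le_id (R : realType) (x : R) : 0 <= x -> sin x <= x.
Proof.
move=> x0.
have D (y : R) : is_derive y 1 (fun y => y - sin y) (1 - cos y) by apply: is_deriveB.
have [] := @MVT_segment R (fun y => y - sin y) (fun y => 1 - cos y) 0 x x0.
- by apply: derivable_within_continuous => y _; have [] := D y.
move=> c _; rewrite sin0 !subr0 => h; rewrite -subr_ge0 h mulr_ge0// subr_ge0; exact: cos_le1.
Qed.

(** This is [x <= tan x] cleared of its denominator; the difference has derivative [y * sin y],
    nonnegative on [[0, pi]]. *)
Lemma mul_cos_le_sin (R : realType) (x : R) : 0 <= x <= pi -> x * cos x <= sin x.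
Proof.
move=> /andP[x0 xpi].
have D (y : R) : is_derive y 1 (fun y => sin y - y * cos y) (y * sin y).
  apply: is_derive_eq; rewrite /GRing.scale/=; ring.
have [] := @MVT_segment R (fun y => sin y - y * cos y) (fun y => y * sin y) 0 x x0.
- by apply: derivable_within_continuous => y _; have [] := D y.
move=> c; rewrite in_itv/= sin0 mul0r !subr0 => /andP[c0 cx] h; rewrite -subr_ge0 h !mulr_ge0//.
by rewrite sin_ge0_pi// c0 (le_trans cx).
Qed.

Lemma csc2_bounds (R : realType) (x : R) : 0 < x < pi / 2 ->
  (sin x ^+ 2)^-1 - 1 <= (x ^+ 2)^-1 <= (sin x ^+ 2)^-1.
Proof.
move=> /andP[x0 x2].
have xpi : x < pi by have := pi_gt0 R; lra.
have s0 : 0 < sin x by rewrite sin_gt0_pi// x0.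
apply/andP; split; last first.
  rewrite lef_pV2 ?posrE ?exprn_gt0// lerXn2r ?nnegrE ?(ltW s0) ?(ltW x0)//.
  by rewrite sin_le_id// ltW.
(* The lower bound is the squared cotangent, so it reduces to [x * cos x <= sin x]. *)
have -> : (sin x ^+ 2)^-1 - 1 = (cos x / sin x) ^+ 2.
  rewrite expr_div_n cos2sin2; field; exact: lt0r_neq0.
have c0 : 0 < cos x.
  by rewrite cos_gt0_pihalf// x2 andbT (lt_trans _ x0)// oppr_lt0 divr_gt0// pi_gt0.
rewrite -exprVn lerXn2r ?nnegrE ?invr_ge0 ?divr_ge0 ?(ltW s0) ?(ltW c0) ?(ltW x0)//.
rewrite ler_pdivrMr// mulrC ler_pdivlMr// mulrC.
by rewrite mul_cos_le_sin// (ltW x0) ltW.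
Qed.

(** The cosine is written as the sine of [pi / 2 - x] because the dyadic grid of angles is symmetric
    under this reflection. *)
Lemma csc2D_sec2 (R : realType) (x : R) : 0 < x < pi / 2 ->
  (sin x ^+ 2)^-1 + (sin (pi / 2 - x) ^+ 2)^-1 = 4 * (sin (x *+ 2) ^+ 2)^-1.
Proof.
move=> /andP[x0 x2].
have s0 : sin x != 0 by rewrite lt0r_neq0// sin_gt0_pihalf// x0.
have c0 : cos x != 0.
  by rewrite lt0r_neq0// cos_gt0_pihalf// x2 andbT (lt_trans _ x0)// oppr_lt0 divr_gt0// pi_gt0.
rewrite sinB sin_pihalf cos_pihalf mul1r mul0r subr0 sin_mulr2n.
have := cos2Dsin2 x => e.
transitivity ((cos x ^+ 2 + sin x ^+ 2) / (cos x ^+ 2 * sin x ^+ 2)).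
  by field; rewrite s0.
by rewrite e; field; rewrite s0.
Qed.

Lemma sum_fold (V : nmodType) (F : nat -> V) N : (0 < N)%N ->
  \sum_(1 <= k < N.*2) F k = \sum_(1 <= k < N) (F k + F (N.*2 - k)%N) + F N.
Proof.
move=> N0; rewrite big_split/= -addrA.
rewrite (@big_cat_nat _ _ _ N)/=; [|lia..]; congr +%R.
rewrite big_ltn; last lia; rewrite addrC; congr +%R.
rewrite [RHS]big_nat_rev/= -[N.+1]add1n big_addn.
rewrite (_ : (N.*2 - N)%N = N); last lia.
by apply: eq_big_nat => i /andP[i1 iN]; congr F; lia.
Qed.

Definition csc2_sum (R : realType) n : R :=
  \sum_(1 <= k < 2 ^ n) (sin (k%:R * pi / (2 ^ n.+1)%:R) ^+ 2)^-1.

Lemma dyadic_angle (R : realType) n k : (1 <= k < 2 ^ n)%N ->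
  0 < (k%:R * pi / (2 ^ n.+1)%:R : R) < pi / 2.
Proof.
move=> /andP[k1 kn]; have p0 := pi_gt0 R; have t0 : 0 < (2 ^ n)%:R :> R.
  by rewrite ltr0n expn_gt0.
rewrite expnS natrM; apply/andP; split.
  by rewrite divr_gt0 ?mulr_gt0// ltr0n.
rewrite ltr_pdivrMr ?mulr_gt0//.
rewrite (_ : pi / 2 * (2 * _) = (2 ^ n)%:R * pi); last by field.
by rewrite ltr_pM2r// ltr_nat.
Qed.

Lemma csc2_sumS (R : realType) n : csc2_sum R n.+1 = 4 * csc2_sum R n + 2.
Proof.
rewrite /csc2_sum {1}(expnS 2 n) mul2n sum_fold ?expn_gt0//; congr +%R; last first.
  (* The unpaired middle term of the folded sum sits at the angle [pi / 4] and contributes 2. *)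
  have -> : (2 ^ n)%:R * pi / (2 ^ n.+2)%:R = pi / 4 :> R.
    rewrite -(addn2 n) expnD natrM; field.
    by rewrite pnatr_eq0 expn_eq0.
  have -> : sin (pi / 4) ^+ 2 = 2^-1 :> R.
    have := cos_mulr2n (pi / 4 : R).
    rewrite (_ : pi / 4 *+ 2 = pi / 2); last by rewrite -mulr_natr; field.
    rewrite cos_pihalf cos2sin2; lra.
  by rewrite invrK.
rewrite mulr_sumr; apply: eq_big_nat => k kn.
set x : R := k%:R * pi / (2 ^ n.+2)%:R.
have t0 : (2 ^ n.+1)%:R != 0 :> R by rewrite pnatr_eq0 expn_eq0.
have t1 : (2 ^ n.+2)%:R = 2 * (2 ^ n.+1)%:R :> R by rewrite expnS natrM.
have -> : k%:R * pi / (2 ^ n.+1)%:R = x *+ 2.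
  by rewrite /x -mulr_natr t1; field.
rewrite -csc2D_sec2; last first.
  apply: dyadic_angle; rewrite expnS; lia.
congr (_ + (sin _ ^+ 2)^-1).
rewrite -mul2n -expnS natrB; last by rewrite expnS; lia.
by rewrite /x t1; field.
Qed.

Lemma csc2_sumE (R : realType) n : csc2_sum R n = 2 / 3 * (4 ^+ n - 1).
Proof.
elim: n => [|n IHn]; first by rewrite /csc2_sum big_geq// subrr mulr0.
by rewrite csc2_sumS IHn exprS; field.
Qed.

(** With [t = 2 ^ n], summing [csc2_bounds] over fewer than [t] angles places [4 * t ^+ 2 * S]
    between [csc2_sum R n - t] and [csc2_sum R n], where the latter is [2 / 3 * (t ^+ 2 - 1)]. *)
Lemma dyadic_basel_bounds (R : realType) n :
  `|\sum_(1 <= k < 2 ^ n) (pi * k%:R) ^- 2 - 6^-1| <= 2 ^- n :> R.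
Proof.
set S := \sum_(_ <= k < _) _.
have p0 := lt0r_neq0 (pi_gt0 R).
set t : R := 2 ^+ n; have t1 : 1 <= t by rewrite exprn_ege1// ler1n.
have t0 : 0 < t by apply: lt_le_trans t1.
have t4 : (2 ^ n.+1)%:R = 2 * t by rewrite expnS natrM natrX.
have SE : 4 * t ^+ 2 * S =
    \sum_(1 <= k < 2 ^ n) ((k%:R * pi / (2 ^ n.+1)%:R) ^+ 2)^-1.
  rewrite mulr_sumr; apply: eq_big_nat => k /andP[k1 _].
  have k0 : k%:R != 0 :> R by rewrite pnatr_eq0 -lt0n.
  by rewrite t4; move: (pi : R) p0 => p p0; field; rewrite (lt0r_neq0 t0) p0.
have Ub : 4 * t ^+ 2 * S <= csc2_sum R n.
  rewrite SE; apply: ler_sum_nat => k kn.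
  by have /andP[] := csc2_bounds (dyadic_angle R kn).
have Lb : csc2_sum R n - t <= 4 * t ^+ 2 * S.
  apply: (@le_trans _ _ (csc2_sum R n - \sum_(1 <= k < 2 ^ n) 1)).
    rewrite lerD2l lerN2 sumr_const_nat /t -natrX ler_nat; lia.
  rewrite -sumrB SE; apply: ler_sum_nat => k kn.
  by have /andP[] := csc2_bounds (dyadic_angle R kn).
have t2 : (4 ^+ n) = t ^+ 2 by rewrite /t -exprM mulnC exprM; congr (_ ^+ _); ring.
rewrite csc2_sumE t2 in Ub Lb.
have tV : t^-1 * t = 1 by rewrite mulVf// lt0r_neq0.
rewrite ler_norml.
have V0 : 0 < t^-1 by rewrite invr_gt0.
have V1 : t^-1 <= 1 by rewrite invf_le1.
(* Scaling by [v ^+ 2] bounds the error by [v ^+ 2 / 6 + v / 4], which is at most [v] since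
   [v <= 1]. *)
set v := t^-1 in tV V0 V1 *.
apply/andP; split.
  have := ler_wpM2l (sqr_ge0 v) Lb.
  rewrite (_ : v ^+ 2 * (4 * t ^+ 2 * S) = 4 * (v * t) ^+ 2 * S); last ring.
  rewrite (_ : v ^+ 2 * _ = 2 / 3 * ((v * t) ^+ 2 - v ^+ 2) - v * (v * t)); last ring.
  rewrite tV; nra.
have := ler_wpM2l (sqr_ge0 v) Ub.
rewrite (_ : v ^+ 2 * (4 * t ^+ 2 * S) = 4 * (v * t) ^+ 2 * S); last ring.
rewrite (_ : v ^+ 2 * _ = 2 / 3 * ((v * t) ^+ 2 - v ^+ 2)); last ring.
rewrite tV; nra.
Qed.

Lemma basel (R : realType) :
  (\sum_(1 <= k <oo) ((pi * k%:R) ^- 2)%:E = (6^-1)%:E :> \bar R)%E.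
Proof.
have e0 k : (0 <= ((pi * k%:R) ^- 2 : R)%:E)%E by rewrite lee_fin invr_ge0 sqr_ge0.
have cv := @is_cvg_nneseries R (fun k => ((pi * k%:R) ^- 2)%:E) xpredT 1 (fun k _ _ => e0 k).
have pow_cvg : (fun n => 2 ^ n)%N @ \oo --> \oo.
  apply/cvgnyPge => N; near=> n; rewrite (@leq_trans n)//; last by rewrite ltnW// ltn_expl.
  by near: n; exact: nbhs_infty_ge.
set u := (fun n => _) in cv.
have h1 : u (2 ^ n)%N @[n --> \oo] --> limn u by exact: (cvg_comp _ _ pow_cvg cv).
(* The partial sums of an [\bar R]-valued nonnegative series converge, so the
   subsequence of indices [2 ^ n] determines the sum. *)
suff h2 : u (2 ^ n)%N @[n --> \oo] --> (6^-1)%:E.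
  exact: (cvg_unique (@ereal_hausdorff _) h1 h2).
rewrite /u; under eq_fun do rewrite sumEFin.
apply: cvg_EFin; first exact: nearW.
have c0 : (2^-1 : R) ^+ n @[n --> \oo] --> 0.
  by apply: cvg_expr; rewrite ger0_norm ?invr_ge0// invf_lt1// ltr1n.
apply/cvgrPdist_le => e e_gt0; near=> n; rewrite /= distrC.
apply: le_trans (dyadic_basel_bounds _ _) _.
rewrite -exprVn -[leLHS]ger0_norm ?exprn_ge0 ?invr_ge0// -[X in `|X|]subr0 distrC.
by near: n; move/cvgrPdist_le : c0; apply.
Unshelve. all: by end_near. Qed.

(** * Measures on countable spaces *)

Lemma measurable_set1_prod d1 d2 (T1 : measurableType d1) (T2 : measurableType d2) :
  (forall x : T1, measurable [set x]) -> (forall x : T2, measurable [set x]) ->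
  forall x : T1 * T2, measurable [set x].
Proof.
move=> m1 m2 [a b]; rewrite (_ : [set _] = [set a] `*` [set b]).
  exact: measurableX.
by apply/seteqP; split => [[x y] [-> ->]|[x y] [/= -> ->]].
Qed.

Lemma measurable_N2 (A : set (nat * nat)) : measurable A.
Proof.
by apply: countable_measurable; [exact: measurable_set1_prod|exact: countableP].
Qed.

Lemma measurable_N3 (A : set N3) : measurable A.
Proof.
apply: countable_measurable; last exact: countableP.
by do 2!apply: measurable_set1_prod => //.
Qed.

Section atoms.
Context d (T : measurableType d) (R : realType) (f : T -> nat).
Hypothesis mT : forall A : set T, measurable A.
Hypothesis f_inj : injective f.

(* [f] enumerates the atoms: [A `&` f @^-1` [set n]] is empty or a singleton. *)
Lemma measure_atoms (mu : {measure set T -> \bar R}) A :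
  mu A = (\sum_(0 <= n <oo) mu (A `&` f @^-1` [set n]))%E.
Proof.
have {1}-> : A = \bigcup_n (A `&` f @^-1` [set n]).
  by apply/seteqP; split => [x Ax|x [n _ []]//]; exists (f x).
rewrite measure_bigcup//; last by move=> i j _ _ [x [[_ <-] [_ <-]]].
by apply: eq_eseriesl => n; rewrite in_setT.
Qed.

Lemma eq_measure_atoms (mu nu : {measure set T -> \bar R}) A :
  (forall x, A x -> mu [set x] = nu [set x]) -> mu A = nu A.
Proof.
move=> e; rewrite [LHS]measure_atoms [RHS]measure_atoms.
apply: eq_eseriesr => n _.
have [[x [Ax fx]]|/set0P/negP/negPn/eqP ->] := pselect (A `&` f @^-1` [set n] !=set0);
  last by rewrite !measure0.
rewrite (_ : _ `&` _ = [set x]) ?e//.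
by apply/seteqP; split => [y [Ay fy]|y ->//]; apply: f_inj; rewrite fx fy.
Qed.

Lemma null_measure_atoms (mu : {measure set T -> \bar R}) A :
  (forall x, A x -> mu [set x] = 0%E) -> mu A = 0%E.
Proof.
by move=> e; rewrite (@eq_measure_atoms mu mzero)// => x /e.
Qed.

(** Meant for fibres of the projections, which are infinite but carry mass at only a few points. *)
Lemma measure_finite_atoms (mu : {measure set T -> \bar R}) A (s : seq T) :
  uniq s -> (forall x, x \in s -> A x) ->
  (forall x, A x -> x \notin s -> mu [set x] = 0%E) ->
  mu A = (\sum_(x <- s) mu [set x])%E.
Proof.
elim: s A => [|y s IHs] A /=.
  by move=> _ _ null; rewrite big_nil null_measure_atoms// => x Ax; exact: null.
move=> /andP[ys us] sA null; rewrite big_cons -(IHs (A `\ y))//.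
- rewrite -measureU//; last by rewrite setDE setICA setICr setI0.
  by rewrite setDUK// => _ ->; apply: sA; rewrite mem_head.
- move=> x xs; split; first by apply: sA; rewrite inE xs orbT.
  by move=> xy; rewrite -xy xs in ys.
- move=> x [Ax xy] xs; apply: null => //.
  by rewrite inE negb_or xs andbT; apply/eqP.
Qed.

End atoms.

(** * The measure mu *)

Definition AB_points (n : nat) : seq N3 :=
  [:: (n.+1, n, n); (n, n.+1, n); (n, n, n.+1);
      (n, n.+1, n.+1); (n.+1, n, n.+1); (n.+1, n.+1, n)].

Lemma AB_pointsP n x : (A_ n `|` B_ n) x <-> x \in AB_points n.
Proof.
rewrite !inE; split; first by move=> [[[|]|]|[[|]|]] ->; rewrite eqxx ?orbT.
by move=> /orP[|/orP[|/orP[|/orP[|/orP[|]]]]] /eqP->; rewrite /A_ /B_/=; tauto.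
Qed.

(** The index is recovered from the point, so distinct layers are disjoint. *)
Lemma AB_points_min n (x : N3) :
  x \in AB_points n -> minn (minn x.1.1 x.1.2) x.2 = n.
Proof.
by rewrite !inE => /orP[|/orP[|/orP[|/orP[|/orP[|]]]]] /eqP->/=; lia.
Qed.

Lemma AB_points_uniq n : uniq (AB_points n).
Proof. by rewrite /= !inE !xpair_eqE; lia. Qed.

Section mu_existence.
Variable R : realType.

Lemma weight_ge0 (n : nat) : 0 <= ((pi * n%:R) ^- 2 : R).
Proof. by rewrite invr_ge0 sqr_ge0. Qed.

(** Assembled from Dirac masses by library operations, so that the measure structure is
    inherited. *)
Definition layer (n : nat) : {measure set N3 -> \bar R} :=
  mscale (NngNum (weight_ge0 n))
    (msum (fun i => \d_(nth (0, 0, 0)%N (AB_points n) i)) 6).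

Definition mu14 : set N3 -> \bar R := mseries layer 1.

HB.instance Definition _ := Measure.on mu14.

Lemma layerE n (A : set N3) :
  layer n A = (((pi * n%:R) ^- 2)%:E * \sum_(x <- AB_points n) \d_x A)%E.
Proof.
rewrite /layer/= /mscale/= /msum; congr (_ * _)%E.
by rewrite (big_nth (0, 0, 0)%N) big_mkord.
Qed.

Lemma mu14_setT : mu14 setT = 1%E.
Proof.
rewrite /mu14 /mseries.
under eq_eseriesr => n _.
  rewrite layerE (eq_bigr (fun=> 1%E)); last by move=> x _; rewrite diracT.
  rewrite big_const_seq/= (_ : (_ + (_ + _))%E = 6%:E); last first.
    by rewrite -!EFinD; congr EFin; ring.
  rewrite muleC.
  over.
rewrite nneseriesZl; last by move=> n _; rewrite lee_fin weight_ge0.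
by rewrite basel -EFinM divff.
Qed.

HB.instance Definition _ := Measure_isProbability.Build _ _ R mu14 mu14_setT.

Lemma layer_set1 n x : layer n [set x] =
  if x \in AB_points n then ((pi * n%:R) ^- 2)%:E else 0%E.
Proof.
rewrite layerE.
have e y : y != x -> \d_y [set x] = 0%E :> \bar R.
  by move=> yx; rewrite diracE memNset//=; exact/eqP.
case: ifPn => xs; last first.
  rewrite big1_seq ?mule0// => y ys; rewrite e//; apply: contraNneq xs => <-.
  by case/andP: ys.
rewrite (bigD1_seq x xs (AB_points_uniq n))/= big1 ?adde0; last exact: e.
by rewrite diracE mem_set// mule1.
Qed.

Lemma mu14_is_mu : is_mu mu14.
Proof.
split => [n n0 x /AB_pointsP xn|x xN].
  rewrite /mu14 /mseries eseries_cond (nneseriesD1 (n := n))//=.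
  rewrite layer_set1 xn eseries0 ?adde0// => k _ /andP[k1 kn].
  rewrite layer_set1 ifN//; apply: contra kn => /AB_points_min <-.
  by rewrite (AB_points_min xn).
rewrite /mu14 /mseries eseries0// => n n1 _; rewrite layer_set1 ifN//.
by apply/negP => /AB_pointsP; exact: xN.
Qed.

End mu_existence.

(** * Uniqueness of the plan *)

Definition near_pair (p : nat * nat) : bool :=
  [&& 0 < p.1, 0 < p.2, p.1 <= p.2.+1 & p.2 <= p.1.+1]%N.

(** These are exactly the points of [A_ n], [B_ n] and the diagonal with [n] at least 1: a set that
    can be read off from the three projections. *)
Definition near_diag (x : N3) : bool :=
  [&& near_pair (pr12 x), near_pair (pr13 x) & near_pair (pr23 x)].

Lemma AB_points_near_diag n x : (0 < n)%N -> x \in AB_points n -> near_diag x.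
Proof.
move=> n0; rewrite !inE.
by move=> /orP[|/orP[|/orP[|/orP[|/orP[|]]]]] /eqP->;
  rewrite /near_diag /near_pair/=; lia.
Qed.

Section uniqueness.
Variables (R : realType) (P Q : probability N3 R).
Hypothesis muP : is_mu P.
Hypothesis marg12 : forall A, measurable A -> pushforward Q pr12 A = pushforward P pr12 A.
Hypothesis marg13 : forall A, measurable A -> pushforward Q pr13 A = pushforward P pr13 A.
Hypothesis marg23 : forall A, measurable A -> pushforward Q pr23 A = pushforward P pr23 A.

Let inj_pickle : injective (@pickle N3) := pcan_inj pickleK.

Lemma is_mu_AB n x : (0 < n)%N -> x \in AB_points n -> P [set x] = ((pi * n%:R) ^- 2)%:E.
Proof. by move=> n0 /AB_pointsP xn; exact: muP.1. Qed.

Lemma is_mu_null x : (forall n, (0 < n)%N -> x \notin AB_points n) -> P [set x] = 0%E.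
Proof.
move=> xN; apply: muP.2 => n n0 /AB_pointsP xn.
by have := xN n n0; rewrite xn.
Qed.

Lemma is_mu_far x : ~~ near_diag x -> P [set x] = 0%E.
Proof.
move=> xN; apply: is_mu_null => n n0.
by apply: contra xN; exact: AB_points_near_diag.
Qed.

Section fibers.
Variable pr : N3 -> nat * nat.
Hypothesis marg : forall A, measurable A -> pushforward Q pr A = pushforward P pr A.
Hypothesis near_pr : forall x, near_diag x -> near_pair (pr x).

(** The whole fibre through [x] has the same mass under [Q] as under [P], and [P] does not charge
    it. *)
Lemma fiber_far x : ~~ near_pair (pr x) -> Q [set x] = 0%E.
Proof.
move=> xN; apply/eqP; rewrite -measure_le0.
have mfib := measurable_N2 [set pr x].
apply: (@le_trans _ _ (Q (pr @^-1` [set pr x]))).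
  by rewrite le_measure ?inE//; [exact: measurable_N3..|move=> y ->].
rewrite [leLHS](marg mfib) /pushforward (null_measure_atoms measurable_N3 inj_pickle)//.
move=> y /= yx; apply: is_mu_far; apply: contra xN => /near_pr.
by rewrite yx.
Qed.

End fibers.

Lemma marginal_far x : ~~ near_diag x -> Q [set x] = 0%E.
Proof.
case/nandP => [|/nandP[]] xN.
- by apply: (fiber_far marg12 _ xN) => y /and3P[].
- by apply: (fiber_far marg13 _ xN) => y /and3P[].
- by apply: (fiber_far marg23 _ xN) => y /and3P[].
Qed.

Let d x : R := fine (Q [set x]) - fine (P [set x]).

(** Both measures give the fibre over [p] the same finite mass, concentrated on [s]. Points of [s]
    away from [near_diag] are harmless, which lets index 0 be treated like the others. *)
Lemma fiber_balance (pr : N3 -> nat * nat) (p : nat * nat) (s : seq N3) :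
  (forall A, measurable A -> pushforward Q pr A = pushforward P pr A) ->
  uniq s -> all (fun x => pr x == p) s ->
  (forall x, pr x = p -> near_diag x -> x \in s) ->
  \sum_(x <- s) d x = 0.
Proof.
move=> marg us /allP sp ps.
have mfib := measurable_N2 [set p].
have atoms (mu : probability N3 R) : (forall x, ~~ near_diag x -> mu [set x] = 0%E) ->
    mu (pr @^-1` [set p]) = (\sum_(x <- s) fine (mu [set x]))%:E.
  move=> far; rewrite (@measure_finite_atoms _ _ _ _ measurable_N3 inj_pickle _ _ s us).
  - rewrite -sumEFin; apply: eq_bigr => x _.
    by rewrite fineK// fin_num_measure//; exact: measurable_N3.
  - by move=> x /sp/eqP.
  - by move=> x xp xs; apply: far; apply: contra xs; exact: ps.
have := marg _ mfib; rewrite /pushforward.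
rewrite (atoms _ is_mu_far) (atoms _ marginal_far) => -[e].
by rewrite /d sumrB e subrr.
Qed.

Local Ltac fiber :=
  [> by rewrite /= ?inE ?xpair_eqE; lia
   | by rewrite /= /pr12 /pr13 /pr23/= ?xpair_eqE ?eqxx
   | by move=> [[x y] z]; rewrite /pr12 /pr13 /pr23/= => -[? ?]; subst;
        rewrite /near_diag /near_pair/= ?inE ?xpair_eqE; lia ].

(* Also holds for [n = 0], where all five values are [0]. *)
Let dA n (a := d (n, n, n.+1)) :
  [/\ d (n.+1, n, n) = a, d (n, n.+1, n) = a, d (n, n.+1, n.+1) = - a,
      d (n.+1, n, n.+1) = - a & d (n.+1, n.+1, n) = - a].
Proof.
have : \sum_(x <- [:: (n.+1, n, n); (n.+1, n, n.+1)]) d x = 0.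
  by apply: (fiber_balance (p := (n.+1, n)) marg12); fiber.
have : \sum_(x <- [:: (n, n.+1, n); (n, n.+1, n.+1)]) d x = 0.
  by apply: (fiber_balance (p := (n, n.+1)) marg12); fiber.
have : \sum_(x <- [:: (n.+1, n, n); (n.+1, n.+1, n)]) d x = 0.
  by apply: (fiber_balance (p := (n.+1, n)) marg13); fiber.
have : \sum_(x <- [:: (n, n, n.+1); (n, n.+1, n.+1)]) d x = 0.
  by apply: (fiber_balance (p := (n, n.+1)) marg13); fiber.
have : \sum_(x <- [:: (n, n, n.+1); (n.+1, n, n.+1)]) d x = 0.
  by apply: (fiber_balance (p := (n, n.+1)) marg23); fiber.
rewrite !big_cons !big_nil /a; split; lra.
Qed.

Let d_diagS n : d (n.+1, n.+1, n.+1) + d (n.+1, n.+1, n.+2) = d (n, n, n.+1).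
Proof.
have : \sum_(x <- [:: (n.+1, n.+1, n); (n.+1, n.+1, n.+1); (n.+1, n.+1, n.+2)]) d x = 0.
  by apply: (fiber_balance (p := (n.+1, n.+1)) marg12); fiber.
have [_ _ _ _ e] := dA n.
rewrite !big_cons !big_nil e; lra.
Qed.

Let d_far x : ~~ near_diag x -> d x = 0.
Proof. by move=> xN; rewrite /d is_mu_far// marginal_far// subrr. Qed.

(** [P] vanishes on the diagonal, so [d] is there the mass of [Q] alone. *)
Let d_diag_ge0 n : 0 <= d (n, n, n).
Proof.
rewrite /d (@is_mu_null (n, n, n)) ?subr0 ?fine_ge0// => m _.
by rewrite !inE !xpair_eqE; lia.
Qed.

Let d_A_ge n : (0 < n)%N -> - (pi * n%:R) ^- 2 <= d (n, n, n.+1).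
Proof.
move=> n0; rewrite /d (@is_mu_AB n)//=; last by rewrite !inE eqxx !orbT.
by rewrite -[leLHS]add0r lerD2r fine_ge0.
Qed.

Let d_A_decr m n : (m <= n)%N -> d (n, n, n.+1) <= d (m, m, m.+1).
Proof.
move=> /subnK <-; elim: (n - m)%N => // k IHk; apply: le_trans IHk.
by rewrite addSn -[leRHS]d_diagS lerDr.
Qed.

Let d_A0 n : d (n, n, n.+1) = 0.
Proof.
have d0 : d (0, 0, 1)%N = 0 by apply: d_far.
apply/eqP; rewrite eq_le -{1}d0 d_A_decr//= leNgt; apply/negP.
rewrite -oppr_gt0; set e := - _ => e0.
(* [N] is at least [n] and exceeds [e^-1]. As [pi] is at least 2, [(pi * N) ^- 2 < e], against the
   lower bound at [N] and the decrease from [n] to [N]. *)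
pose N := (Num.truncn e^-1 + n).+1%N.
have [N0 nN] : (0 < N)%N /\ (n <= N)%N.
  by split; rewrite // leqW// leq_addl.
have eN : e^-1 < N%:R.
  apply: lt_le_trans (truncnS_gt _) _; by rewrite ler_nat ltnS leq_addr.
have := le_trans (d_A_ge N0) (d_A_decr nN); rewrite lerNl -/e leNgt => /negP; apply.
have N1 : 1 <= N%:R :> R by rewrite ler1n.
have := pi_ge2 R => p2.
rewrite invf_plt ?posrE ?exprn_gt0 ?mulr_gt0 ?pi_gt0 ?ltr0n//.
apply: lt_le_trans eN _.
have piN : N%:R <= pi * N%:R :> R by rewrite ler_peMl//; lra.
rewrite (le_trans piN)// expr2 ler_peMl//; lra.
Qed.

Let d_eq0 x : d x = 0.
Proof.
have [|/d_far //] := boolP (near_diag x).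
have dd n : d (n, n, n) = 0.
  case: n => [|n]; first exact: d_far.
  by have := d_diagS n; rewrite !d_A0 addr0.
case: x => [[i j] k] /and3P[/and4P[/= i0 j0 ij ji] /and4P[/= _ k0 ik ki] /and4P[/= _ _ jk kj]].
(* Every coordinate is [n] or [n.+1]; of the eight cases, two are diagonal and six are covered by
   [dA]. *)
pose n := minn (minn i j) k.
have [e1 e2 e3 e4 e5] := dA n; rewrite d_A0 oppr0 in e1 e2 e3 e4 e5.
have hi : i = n \/ i = n.+1 by rewrite /n; lia.
have hj : j = n \/ j = n.+1 by rewrite /n; lia.
have hk : k = n \/ k = n.+1 by rewrite /n; lia.
case: hi => ->; case: hj => ->; case: hk => -> //; rewrite ?d_A0//.
Qed.

Lemma marginals_unique A : Q A = P A.
Proof.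
apply: (eq_measure_atoms measurable_N3 inj_pickle) => x _.
have fin (mu : probability N3 R) : mu [set x] \is a fin_num.
  by rewrite fin_num_measure//; exact: measurable_N3.
suff e : Q [set x] = P [set x] by exact: e.
by rewrite -(fineK (fin Q)) -(fineK (fin P)); congr EFin; apply/subr0_eq/d_eq0.
Qed.

End uniqueness.

(** * Absence of dual potentials *)

(** The repeated coordinate is the smaller value in [A_ n] and the larger one in any [B_ m], so the
    two families never meet. *)
Lemma cost_A (R : realType) n x : A_ n x -> cost R x = 0.
Proof.
rewrite /cost; case: asboolP => // -[m [_]].
by move=> [[|]|] -> [[|]|] [? ? ?]; lia.
Qed.

Lemma cost_diag (R : realType) n : cost R (n, n, n) = 0.
Proof.
by rewrite /cost; case: asboolP => // -[m [_]] [[|]|] [? ? ?]; lia.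
Qed.

Lemma cost_B (R : realType) n x : (0 < n)%N -> B_ n x -> cost R x = 1.
Proof. by rewrite /cost => n0 Bx; case: asboolP => // -[]; exists n. Qed.

(** A term [-oo] would absorb the sum. Each tight equality thus becomes one between reals, which can
    be subtracted. *)
Lemma fsum_fin (R : realType) (f12 f13 f23 : nat -> nat -> \bar R) i j k r :
  no_pinfty f12 -> no_pinfty f13 -> no_pinfty f23 ->
  fsum f12 f13 f23 (i, j, k) = r%:E ->
  [/\ f12 i j \is a fin_num, f13 i k \is a fin_num, f23 j k \is a fin_num &
      fine (f12 i j) + fine (f13 i k) + fine (f23 j k) = r].
Proof.
move=> /(_ i j) + /(_ i k) + /(_ j k); rewrite /fsum/=.
by case: (f12 i j) (f13 i k) (f23 j k) => [?||] [?||] [?||] //= _ _ _ [].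
Qed.

Lemma no_tight_potentials (R : realType) (f12 f13 f23 : nat -> nat -> \bar R) :
  no_pinfty f12 -> no_pinfty f13 -> no_pinfty f23 ->
  (forall x, (fsum f12 f13 f23 x <= (cost R x)%:E)%E) ->
  ~ (forall n x, (0 < n)%N -> x \in AB_points n ->
       fsum f12 f13 f23 x = (cost R x)%:E).
Proof.
move=> n12 n13 n23 fle feq.
pose F n := fine (f12 n n) + fine (f13 n n) + fine (f23 n n).
have fA i j k n : (0 < n)%N -> A_ n (i, j, k) ->
    [/\ f12 i j \is a fin_num, f13 i k \is a fin_num, f23 j k \is a fin_num &
      fine (f12 i j) + fine (f13 i k) + fine (f23 j k) = 0].
  move=> n0 Ax; apply: fsum_fin => //; rewrite -(@cost_A _ n (i, j, k))//.
  by apply: (feq n) => //; apply/AB_pointsP; left.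
have fB i j k n : (0 < n)%N -> B_ n (i, j, k) ->
    fine (f12 i j) + fine (f13 i k) + fine (f23 j k) = 1.
  move=> n0 Bx.
  have [] // := @fsum_fin _ f12 f13 f23 i j k 1 n12 n13 n23.
  rewrite -(@cost_B _ n (i, j, k))//.
  by apply: (feq n) => //; apply/AB_pointsP; right.
have F_le0 n : (0 < n)%N -> F n <= 0.
  move=> n0; have := fle (n, n, n); rewrite cost_diag /fsum/=.
  (* No equality is known at [(n, n, n)]; each of its three terms is finite because it also occurs
     at a point of [A_ n]. *)
  have [_ _ r23 _] : _ := @fA n.+1 n n n n0 ltac:(by left; left).
  have [_ r13 _ _] : _ := @fA n n.+1 n n n0 ltac:(by left; right).
  have [r12 _ _ _] : _ := @fA n n n.+1 n n0 ltac:(by right).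
  by rewrite -(fineK r12) -(fineK r13) -(fineK r23) -!EFinD lee_fin.
have FS n : (0 < n)%N -> F n.+1 = F n + 3.
  move=> n0; rewrite /F.
  have [_ _ _ a1] : _ := @fA n.+1 n n n n0 ltac:(by left; left).
  have [_ _ _ a2] : _ := @fA n n.+1 n n n0 ltac:(by left; right).
  have [_ _ _ a3] : _ := @fA n n n.+1 n n0 ltac:(by right).
  have b1 := @fB n n.+1 n.+1 n n0 ltac:(by left; left).
  have b2 := @fB n.+1 n n.+1 n n0 ltac:(by left; right).
  have b3 := @fB n.+1 n.+1 n n n0 ltac:(by right).
  lra.
have F_lin n : F n.+1 = F 1%N + 3 * n%:R.
  elim: n => [|n IHn]; first by rewrite mulr0 addr0.
  by rewrite FS// IHn -natr1; ring.
(* With [k] the truncation of [- F 1] plus one, [k > - F 1] and [k >= 0] make [F 1 + 3 * k]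
   positive. *)
have := F_le0 (Num.truncn (- F 1%N)).+2 isT; rewrite F_lin.
have := truncnS_gt (- F 1%N).
have : 0 <= (Num.truncn (- F 1%N)).+1%:R :> R by [].
lra.
Qed.

(** Each such point is an atom of positive mass, so an equality holding off a null set holds at all
    of them. *)
Lemma is_mu_pos_notin (R : realType) (P : probability N3 R) (N : set N3) :
  is_mu P -> P N = 0%E -> forall n x, (0 < n)%N -> x \in AB_points n -> ~ N x.
Proof.
move=> muP PN n x n0 xn Nx.
have : (P [set x] <= P N)%E.
  by rewrite le_measure ?inE//; [exact: measurable_N3..|move=> y ->].
rewrite PN (is_mu_AB muP n0 xn) lee_fin leNgt => /negP; apply.
by rewrite invr_gt0 exprn_gt0// mulr_gt0 ?pi_gt0// ltr0n.
Qed.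

Theorem mainTheorem14 (R : realType) :
  (exists P : probability N3 R, is_mu P) /\
  forall P : probability N3 R, is_mu P ->
  [/\ (* P is the only probability measure with marginals mu12, mu13, mu23 *)
      (forall Q : probability N3 R,
         (forall A, measurable A -> pushforward Q pr12 A = pushforward P pr12 A) ->
         (forall A, measurable A -> pushforward Q pr13 A = pushforward P pr13 A) ->
         (forall A, measurable A -> pushforward Q pr23 A = pushforward P pr23 A) ->
         forall A, measurable A -> Q A = P A),
      (* no dual potentials with equality P-a.e. *)
      ~ (exists f12 f13 f23 : nat -> nat -> \bar R,
           [/\ no_pinfty f12, no_pinfty f13, no_pinfty f23,
               (forall x, (fsum f12 f13 f23 x <= (cost R x)%:E)%E) &
               {ae P, forall x, fsum f12 f13 f23 x = (cost R x)%:E}]) &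
      (* in particular *)
      ~ strongly_c_monotone P (@cost R)].
Proof.
split; first by exists (mu14 R); exact: mu14_is_mu.
move=> P muP; split.
- by move=> Q m12 m13 m23 A _; exact: marginals_unique.
- move=> [f12] [f13] [f23] [n12 n13 n23 fle [N [_ PN subN]]].
  apply: (no_tight_potentials n12 n13 n23 fle) => n x n0 xn.
  by apply: contrapT => fx; apply: (is_mu_pos_notin muP PN n0 xn); exact: subN.
- move=> [G] [_] [PG] [f12] [f13] [f23] [[n12 n13 n23]] [_] [fle feq].
  apply: (no_tight_potentials n12 n13 n23 fle) => n x n0 xn.
  by apply: feq; apply: contrapT; exact: (is_mu_pos_notin muP PG n0 xn).
Qed.
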